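(* Every finite CID-groupoid is a Płonka sum of Latin squares.
   Context: A groupoid is a set with one binary operation, written as juxtaposition. A CID-groupoid is a groupoid that is commutative, idempotent ($xx\approx x$) and distributive ($x(yz)\approx(xy)(xz)$). A Latin square is a groupoid $\langle A,\cdot\rangle$ such that for any $a,b\in A$ there are unique $c,d\in A$ with $a\cdot c=b$ and $d\cdot a=b$. Płonka sum (for groupoids): let $\langle S,\vee\rangle$ be a semilattice ordered by $x\le_\vee y\Leftrightarrow x\vee y=y$, let $\{\mathbf{A}_s: s\in S\}$ be a collection of groupoids (with disjoint universes), and let $\{\phi_{s,t}\colon\mathbf{A}_s\to\mathbf{A}_t : s\le_\vee t\}$ be homomorphisms with $\phi_{s,s}=1_{A_s}$ and $\phi_{t,u}\circ\phi_{s,t}=\phi_{s,u}$. The Płonka sum of this system is the groupoid with universe the disjoint union of the $A_s$ and product $x\cdot y=\phi_{s,s\vee t}(x)\cdot\phi_{t,s\vee t}(y)$, computed in $\mathbf{A}_{s\vee t}$, for $x\in A_s$, $y\in A_t$. It is a Płonka sum of Latin squares if every $\mathbf{A}_s$ is a Latin square. *)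

(* Defs.v *)
From HB Require Import structures.
From mathcomp Require Import all_boot all_order.

Set Implicit Arguments.
Unset Strict Implicit.
Unset Printing Implicit Defensive.

Import Order.LTheory.

Local Open Scope order_scope.

(* A groupoid in the universal-algebraic sense is a [magmaType]: a type with one
   binary operation and no axioms, and a homomorphism is a [{multiplicative _ -> _}]. *)
#[short(type="finMagmaType")]
HB.structure Definition FinMagma := {G of Magma G & Finite G}.

Definition CID_groupoid (G : magmaType) : Prop :=
  [/\ commutative (@mul G),
      idempotent_op (@mul G)
    & right_distributive (@mul G) (@mul G)].

Definition latin_square (G : magmaType) : Prop :=
  forall a b : G,
    (exists! c : G, (a * c)%g = b) /\ (exists! e : G, (e * a)%g = b).

(* The order of a [joinSemilatticeType] satisfies [(s <= t) = (s `|` t == t)]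
   (lemma [leEjoin]).  As [s <= t] is boolean, its proofs are unique, so the maps
   of a system depend only on the endpoints [s] and [t]. *)
Record plonka_system (d : Order.disp_t) (S : joinSemilatticeType d) :=
  PlonkaSystem {
    summand :> S -> magmaType;
    transition : forall s t : S,
      s <= t -> {multiplicative summand s -> summand t};
    transition_id : forall (s : S) (ss : s <= s) (x : summand s),
      transition ss x = x;
    transition_comp : forall (s t u : S) (st : s <= t) (tu : t <= u)
        (su : s <= u) (x : summand s),
      transition tu (transition st x) = transition su x
  }.

Section PlonkaSum.
Variables (d : Order.disp_t) (S : joinSemilatticeType d).
Variable A : plonka_system S.

Definition plonka_sum : Type := {s : S & A s}.

Definition plonka_mul (x y : plonka_sum) : plonka_sum :=
  existT (fun s : S => A s : Type) (tag x `|` tag y)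
    (transition A (leUl (tag x) (tag y)) (tagged x) *
     transition A (leUr (tag y) (tag x)) (tagged y))%g.

HB.instance Definition _ := hasMul.Build plonka_sum plonka_mul.

End PlonkaSum.

Definition isomorphic (G H : magmaType) : Prop :=
  exists f : {multiplicative G -> H}, bijective f.

Definition plonka_sum_of_latin_squares (G : magmaType) : Prop :=
  exists (d : Order.disp_t) (S : joinSemilatticeType d) (A : plonka_system S),
    (forall s : S, latin_square (A s)) /\ isomorphic G (plonka_sum A).

(* Main.v *)
Require Import Defs.
From HB Require Import structures.
From mathcomp Require Import all_boot all_order.

Set Implicit Arguments.
Unset Strict Implicit.
Unset Printing Implicit Defensive.

(** In a Plonka sum of finite Latin squares, left multiplication by an element
    [a] of the component [s] sends the component [t] into the component
    [s `|` t], by the transition map followed by a permutation.  A power of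
    this multiplication with a suitable exponent therefore is the transition
    map itself, and this recovers the system from the product.

    So let [A] be a finite CID-groupoid, [n] the factorial of its cardinal, and
    [e_a] (below, [retract a]) the [n]-th iterate of multiplication by [a]; it
    is an idempotent endomorphism of [A] that fixes [a].  The theorem reduces
    to the single identity [e_(a * b) = e_a e_b] ([retract_mulE]): since [A] is
    commutative, the maps [e_a] then commute, so that they form a semilattice
    under composition.  Two elements lie in the same component when they have
    the same map [e_a], and the maps [e_a] themselves are the transition maps.
    This is Plonka's theorem on partition functions ([plonka_decomposition]).
    If [e_a = e_b], then [e_a b = e_b b = b], so multiplication by [a] permutes
    its own component, which hence is a Latin square.

    The identity comes from two facts about a product [d = a * c].
    - [e_d e_a = e_d] ([retract_mul]).  Distributivity on both sides shows that
      if multiplication by [a * c] is injective on a subgroupoid that contains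
      [a] and [c], so is multiplication by [a] ([mul_factor_inj]).  This applies
      in the image of [e_d], where multiplication by [d] is bijective.
    - [e_a d = d] ([retract_mulK]).  The first fact only shows that [d] and
      [f = e_a d] are sent to each other by [e_f] and [e_d]; that they are equal
      follows by running backwards along the iterates of [f] under
      multiplication by [d], which end in [d]. *)

(** * Iterated multiplication in a finite CID-groupoid *)

(** The tail and the period of every orbit of [f] are at most [#|T|], so the
    factorial exceeds the former and is a multiple of the latter. *)
Lemma iter_fact_card_idem (T : finType) (f : T -> T) (x : T) :
  iter #|T|`! f (iter #|T|`! f x) = iter #|T|`! f x.
Proof.
have /trajectP[i lt_i eq_i] := looping_order f x.
have le_n : order f x <= #|T| by exact: max_card.
have perE j q : i <= j -> iter (q * (order f x - i) + j) f x = iter j f x.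
  move=> le_ij; elim: q => [|q IHq] //; rewrite mulSn -addnA.
  rewrite -[RHS]IHq -(subnK (leq_trans le_ij (leq_addl (q * _) j))).
  rewrite addnCA iterD subnK ?(ltnW lt_i) // eq_i -iterD //.
have /dvdnP[q {1}->] : order f x - i %| #|T|`!.
  by apply: dvdn_fact; rewrite subn_gt0 lt_i (leq_trans (leq_subr _ _)).
rewrite -iterD perE // (leq_trans (ltnW lt_i)) // (leq_trans le_n) //.
by case: #|T| => // m; rewrite factS leq_pmulr ?fact_gt0.
Qed.

Section Distributive.
Local Open Scope group_scope.

Lemma iter_mul_morph (G H : magmaType) (f : G -> H) k (a x : G) :
  {morph f : x y / x * y} ->
  f (iter k (mul a) x) = iter k (mul (f a)) (f x).
Proof. by move=> fM; elim: k => //= k <-; rewrite fM. Qed.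

(** The identity [(a * c) * (c * z) = c * (a * z)] shows that an equality
    [a * u = a * v] passes to [c], and [(a * c) * z = (a * z) * (c * z)] then
    combines both into an equality for [a * c]. *)
Lemma mul_factor_inj (G : magmaType) (B : {pred G}) (a c : G) :
    commutative (@mul G) -> right_distributive (@mul G) (@mul G) ->
    mulg_closed B -> a \in B -> c \in B ->
  {in B &, injective (mul (a * c))} -> {in B &, injective (mul a)}.
Proof.
move=> mulC mulD BM aB cB inj_ac u v uB vB eq_a.
have factor z : (a * c) * (c * z) = c * (a * z) by rewrite [a * c]mulC -mulD.
have eq_c : c * u = c * v.
  by apply: inj_ac; rewrite ?factor ?eq_a ?BM.
have split z : (a * c) * z = (a * z) * (c * z).
  by rewrite mulC mulD ![z * _]mulC.
by apply: inj_ac => //; rewrite !split eq_a eq_c.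
Qed.

Definition retract (G : finMagmaType) (a : G) : G -> G := iter #|G|`! (mul a).

Variables (A : finMagmaType) (cidA : CID_groupoid A).
Implicit Types a b c d x y : A.

Let mulC : commutative (@mul A). Proof. by case: cidA. Qed.
Let mulxx : idempotent_op (@mul A). Proof. by case: cidA. Qed.
Let mulD : right_distributive (@mul A) (@mul A). Proof. by case: cidA. Qed.

Lemma retractS a x : retract a x = a * iter #|A|`!.-1 (mul a) x.
Proof. by rewrite -iterS prednK ?fact_gt0. Qed.

Lemma retractM a : {morph retract a : x y / x * y}.
Proof. by move=> x y; rewrite /retract; elim: _`! => //= k ->; apply: mulD. Qed.

Lemma retract_mul_fixed a x : a * x = x -> retract a x = x.
Proof. by move=> ax; rewrite /retract; elim: _`! => //= k ->. Qed.

Lemma retract_id a : retract a a = a.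
Proof. exact/retract_mul_fixed/mulxx. Qed.

Lemma retract_idem a x : retract a (retract a x) = retract a x.
Proof. exact: iter_fact_card_idem. Qed.

Lemma retract_conj a b x :
  retract a (retract b x) = retract (retract a b) (retract a x).
Proof. exact/iter_mul_morph/retractM. Qed.

(** On the image of [retract x], the map [retract b] is both injective and
    idempotent. *)
Lemma retract_inj_fixed b x :
    {in [pred y | retract x y == y] &, injective (mul b)} ->
    retract x b = b ->
  forall y, retract x y = y -> retract b y = y.
Proof.
set B := [pred y | _ ] => inj_b xb y xy.
have BL k z : z \in B -> iter k (mul b) z \in B.
  move=> zB; elim: k => //= k /eqP IHk.
  by rewrite inE retractM xb IHk.
suff inj_iter k : {in B &, injective (iter k (mul b))}.
  by apply: (inj_iter #|A|`!); rewrite ?BL ?inE ?xy //; apply: retract_idem.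
elim: k => [|k IHk] u v uB vB //= /inj_b eq_k.
by apply: IHk => //; apply: eq_k; apply: BL.
Qed.

(** The factors of [d] need not lie in the image of [retract d], but their
    images under [retract d] do, and their product still is [d]. *)
Lemma mul_retract_fixed a c x :
  let d := a * c in retract d x = x -> retract (retract d a) x = x.
Proof.
move=> d; set a' := retract d a; set c' := retract d c.
have fix_a' : retract d a' = a' by apply: retract_idem.
have fix_c' : retract d c' = c' by apply: retract_idem.
have d_a'c' : d = a' * c' by rewrite -retractM retract_id.
apply: retract_inj_fixed => //.
apply: (mul_factor_inj (c := c')); rewrite ?inE ?fix_a' ?fix_c' //.
  by move=> u v /eqP du /eqP dv; rewrite inE retractM du dv.
rewrite -d_a'c' => u v /eqP du /eqP dv duv.
by rewrite -du -dv /retract -(prednK (fact_gt0 #|A|)) !iterSr duv.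
Qed.

Lemma retract_mul a c x : retract (a * c) (retract a x) = retract (a * c) x.
Proof.
rewrite retract_conj mul_retract_fixed //; apply: retract_idem.
Qed.

Lemma retract_fixed a b x :
  retract a b = b -> retract b (retract a x) = retract b x.
Proof. by move=> <-; rewrite [retract a b]retractS retract_mul. Qed.

Lemma retract_fixed_l a b x :
  retract a b = b -> retract a (retract b x) = retract b x.
Proof. by move=> ab; rewrite retract_conj ab retract_fixed. Qed.

(** Multiplication by [a] reaches its eventual image in a single step.  This is
    where commutativity is used in the form [d * w = w * d]: an iterate [w] with
    [d * w = d] satisfies [retract w d = d], but [retract w] agrees on [d] and
    on [w], hence [w = d]. *)
Lemma retract_mulK a x : retract a (a * x) = a * x.
Proof.
set d := a * x; set f := retract a d.
have def_f : f = a * retract a x by rewrite /f retractM retract_id.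
have df : retract d f = d by rewrite retract_mul retract_id.
have fd : retract f d = f.
  by rewrite -[RHS]retract_id {3}/f def_f retract_mul.
have step k : iter k.+1 (mul d) f = d -> iter k (mul d) f = d.
  rewrite iterS => dw.
  have wd : retract (iter k (mul d) f) d = d.
    by apply: retract_mul_fixed; rewrite mulC.
  case: k dw wd => [_ <- //|k]; set w := iter k.+1 _ _ => dw wd.
  (* d is a factor of w, so retract w factors through retract d *)
  have dw' : retract d w = d.
    rewrite /w iter_mul_morph ?retract_id ?df; last exact: retractM.
    by elim: k.+1 => //= m ->.
  have: retract w (retract d w) = retract w w by apply: retract_mul.
  by rewrite dw' wd retract_id.
by move: df; rewrite /retract; elim: _`! => // k IHk /step.
Qed.

Lemma retract_fixed_trans a b c :
  retract a b = b -> retract b c = c -> retract a c = c.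
Proof. by move=> ab <-; apply: retract_fixed_l. Qed.

Lemma retract_retract a b x :
  retract a (retract b x) = retract (retract a b) x.
Proof. by rewrite retract_conj retract_fixed // retract_idem. Qed.

Lemma retract_fixed_anti a b x :
  retract a b = b -> retract b a = a -> retract a x = retract b x.
Proof.
by move=> ab ba; rewrite -(retract_fixed_l x ba) retract_fixed.
Qed.

(** The elements [p k] obtained from [a * b] by multiplying by [a] increase in
    the preorder [retract x y = y]; as they run through a cycle, they are all
    equivalent, and so have the same retraction.  Both [a * b] and
    [retract a b] are among them. *)
Lemma retract_mulE a b x : retract (a * b) x = retract a (retract b x).
Proof.
rewrite retract_retract; pose p k := iter k (mul a) (a * b).
have up k j : retract (p k) (p (k + j)) = p (k + j).
  elim: j => [|j IHj]; first by rewrite addn0 retract_id.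
  rewrite addnS; apply: (retract_fixed_trans IHj).
  have -> : p (k + j).+1 = p (k + j) * a by rewrite /p /= mulC.
  exact: retract_mulK.
have -> : retract a b = p #|A|`!.-1 by rewrite /p -iterSr prednK ?fact_gt0.
apply: retract_fixed_anti; first exact: (up 0).
have <- : p #|A|`!.-1.+1 = a * b.
  by rewrite prednK ?fact_gt0 //; apply: retract_mulK.
by rewrite -addn1 up.
Qed.

Lemma retractC a b x : retract a (retract b x) = retract b (retract a x).
Proof. by rewrite -!retract_mulE mulC. Qed.

End Distributive.

(** * Plonka's decomposition by a partition function *)

(** Plonka's partition operation [x o a], written [pact a x]: the laws say that
    [o] is a left normal band and that it is compatible with the product in
    both arguments. *)
Record partition_function (A : magmaType) := PartitionFunction {
  pact :> A -> A -> A;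
  pact_id : forall a, pact a a = a;
  pactA : forall a b x, pact (pact a b) x = pact a (pact b x);
  pactC : forall a b x, pact a (pact b x) = pact b (pact a x);
  pactM : forall a, {morph pact a : x y / (x * y)%g};
  pact_mulE : forall a b x, pact (a * b)%g x = pact a (pact b x)
}.

Section Plonka.
Variables (A : finMagmaType) (P : partition_function A).
Implicit Types a b x y : A.

(** A component is represented by the common action [pact a] of its elements,
    as a finite function, so that joins become composites. *)
Definition component : Type :=
  {f : {ffun A -> A} | f \in codom (fun a => [ffun x => P a x])}.
HB.instance Definition _ := SubChoice.on component.
Implicit Types s t u : component.

Definition component_of a : component :=
  exist _ [ffun x => P a x] (codom_f (fun a => [ffun x => P a x]) a).

Lemma component_ofE a x : val (component_of a) x = P a x.
Proof. by rewrite ffunE. Qed.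

Lemma componentP s : exists a, component_of a = s.
Proof. by case/codomP: (valP s) => a def_s; exists a; apply: val_inj. Qed.

Lemma component_eq s t : (forall x, val s x = val t x) -> s = t.
Proof. by move=> eq_st; apply/val_inj/ffunP. Qed.

Definition component_join s t : component :=
  component_of (iinv (valP s) * iinv (valP t))%g.

Lemma component_joinE s t x : val (component_join s t) x = val s (val t x).
Proof.
have reprE u y : P (iinv (valP u)) y = val u y.
  by have /ffunP/(_ y) := f_iinv (valP u); rewrite ffunE.
by rewrite component_ofE pact_mulE !reprE.
Qed.

Lemma component_ofM a b :
  component_of (a * b)%g = component_join (component_of a) (component_of b).
Proof.
by apply: component_eq => x; rewrite component_joinE !component_ofE pact_mulE.
Qed.

Lemma component_of_pact s x :
  component_of (val s x) = component_join s (component_of x).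
Proof.
apply: component_eq => y; case: (componentP s) => a <-.
by rewrite component_joinE !component_ofE pactA.
Qed.

Lemma component_joinC : commutative component_join.
Proof.
move=> s t; apply: component_eq => x; rewrite !component_joinE.
case: (componentP s) (componentP t) => [a <-] [b <-].
by rewrite !component_ofE pactC.
Qed.

Lemma component_joinA : associative component_join.
Proof. by move=> s t u; apply: component_eq => x; rewrite !component_joinE. Qed.

Lemma component_joinxx : idempotent_op component_join.
Proof.
move=> s; apply: component_eq => x; rewrite component_joinE.
by case: (componentP s) => a <-; rewrite !component_ofE -pactA pact_id.
Qed.

Definition component_le s t := component_join t s == t.

Lemma component_le_refl : reflexive component_le.
Proof. by move=> s; apply/eqP/component_joinxx. Qed.

Lemma component_le_anti : antisymmetric component_le.
Proof. by move=> s t /andP[/eqP st /eqP <-]; rewrite component_joinC. Qed.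

Lemma component_le_trans : transitive component_le.
Proof.
by move=> t s u /eqP st /eqP <-; rewrite /component_le -component_joinA st.
Qed.

HB.instance Definition _ := Order.Le_isPOrder.Build (Order.Disp tt tt) component
  component_le_refl component_le_anti component_le_trans.

HB.instance Definition _ := Order.POrder_Join_isSemilattice.Build
  (Order.Disp tt tt) component component_joinC component_joinA
  (fun _ _ => erefl).

(** ** The system of fibers *)

Definition fiber s : Type := {x : A | component_of x == s}.
HB.instance Definition _ s := SubChoice.on (fiber s).

Lemma fiber_mul_closed s :
  mulg_closed [pred x | component_of x == s].
Proof.
by move=> x y /eqP xs /eqP ys; rewrite inE component_ofM xs ys component_joinxx.
Qed.

HB.instance Definition _ s :=
  SubChoice_isSubMagma.Build A _ (fiber s) (@fiber_mul_closed s).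

Lemma pact_fiber s (x : fiber s) : val s (val x) = val x.
Proof. by case: x => x /= /eqP <-; rewrite component_ofE pact_id. Qed.

(** A component acts as the transition map into its own fiber. *)
Lemma fiber_map_subproof s t (st : (s <= t)%O) (x : fiber s) :
  component_of (val t (val x)) == t.
Proof. by rewrite component_of_pact (eqP (valP x)). Qed.

Definition fiber_map s t (st : (s <= t)%O) (x : fiber s) : fiber t :=
  exist _ (val t (val x)) (fiber_map_subproof st x).

Lemma fiber_mapM s t (st : (s <= t)%O) :
  {morph fiber_map st : x y / (x * y)%g}.
Proof.
move=> x y; apply: val_inj; rewrite valM /=.
by case: (componentP t) => a <-; rewrite !component_ofE pactM.
Qed.

HB.instance Definition _ s t (st : (s <= t)%O) :=
  isMultiplicative.Build (fiber s) (fiber t) (fiber_map st) (fiber_mapM st).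

Lemma fiber_map_id s (ss : (s <= s)%O) (x : fiber s) : fiber_map ss x = x.
Proof. exact/val_inj/pact_fiber. Qed.

Lemma fiber_map_comp s t u (st : (s <= t)%O) (tu : (t <= u)%O)
    (su : (s <= u)%O) (x : fiber s) :
  fiber_map tu (fiber_map st x) = fiber_map su x.
Proof. by apply: val_inj; rewrite /= -component_joinE (eqP tu). Qed.

Definition fiber_system : plonka_system component :=
  PlonkaSystem (summand := fiber)
    (transition := fun s t st => fiber_map st : {multiplicative _ -> _})
    fiber_map_id fiber_map_comp.

Definition forget_component (u : plonka_sum fiber_system) : A :=
  val (tagged u : fiber _).

Lemma forget_component_inj : injective forget_component.
Proof.
move=> [s [x xs]] [t [y yt]]; rewrite /forget_component /= => eq_xy.
move: yt; rewrite -{}eq_xy => yt.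
have [es et] := (eqP xs, eqP yt).
move: xs yt; rewrite -es -et => xs yt.
by rewrite (bool_irrelevance xs yt).
Qed.

Definition to_fiber x : plonka_sum fiber_system :=
  existT (fun s => fiber_system s : Type) (component_of x)
    (exist _ x (eqxx (component_of x))).

(** The product in the sum is computed after moving [x] and [y] by the action of
    [x * y], which fixes [x * y] and is an endomorphism. *)
Lemma to_fiberM : {morph to_fiber : x y / (x * y)%g}.
Proof.
move=> x y; apply: forget_component_inj.
transitivity (P (x * y)%g x * P (x * y)%g y)%g; first by rewrite -pactM pact_id.
by rewrite -!component_ofE component_ofM.
Qed.

HB.instance Definition _ :=
  isMultiplicative.Build A (plonka_sum fiber_system) to_fiber to_fiberM.

Lemma plonka_decomposition : isomorphic A (plonka_sum fiber_system).
Proof.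
exists (to_fiber : {multiplicative _ -> _}); exists forget_component => // u.
exact: forget_component_inj.
Qed.

End Plonka.

(** * Fibers of a CID-groupoid are Latin squares *)

Lemma iter_mul_latin_square (G : magmaType) n :
    commutative (@mul G) ->
  (forall a b : G, iter n.+1 (mul a) b = b) -> latin_square G.
Proof.
move=> mulC mulK a b.
have solve : exists! c, (a * c)%g = b.
  exists (iter n (mul a) b); split=> [|c <-]; first by rewrite -iterS.
  by rewrite -iterSr.
split=> //; case: solve => c [ac uniq_c]; exists c.
by split=> [|e ea]; [rewrite mulC | apply: uniq_c; rewrite mulC].
Qed.

Definition retract_partition (A : finMagmaType) (cidA : CID_groupoid A) :
    partition_function A :=
  PartitionFunction (retract_id cidA)
    (fun a b x => esym (retract_retract cidA a b x))
    (retractC cidA) (retractM cidA) (retract_mulE cidA).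

(** Elements of one fiber act by the same retraction, so each of them fixes the
    whole fiber: an iterate of its multiplication is the identity. *)
Lemma retract_fiber_latin (A : finMagmaType) (cidA : CID_groupoid A)
  (s : component (retract_partition cidA)) : latin_square (fiber s).
Proof.
apply: (@iter_mul_latin_square _ #|A|`!.-1) => [x y|x y]; apply: val_inj.
  by have [mulC _ _] := cidA; rewrite !valM mulC.
rewrite prednK ?fact_gt0 // (iter_mul_morph _ _ _ (@valM _ _ (fiber s))).
transitivity (val (component_of (retract_partition cidA) (val x)) (val y)).
  by rewrite component_ofE.
by rewrite (eqP (valP x)) pact_fiber.
Qed.

Theorem theorem7p2 (A : finMagmaType) (cidA : CID_groupoid A) :
  plonka_sum_of_latin_squares A.
Proof.
exists _, (component (retract_partition cidA)), (fiber_system _).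
by split; [apply: retract_fiber_latin | apply: plonka_decomposition].
Qed.
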